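(* Let $(X,d_X,\mu_X)$ be a metric measure space with $X$ finite and $\mu_X$ fully supported, and let $(Y,d_Y)$ be a nonempty proper metric space admitting a cocompact action by isometries by some group $G$. Then for any $p\in[1,\infty]$ there exists a function $f:X\to Y$ such that $$d_{\mathrm{srGW},p}(X,Y)=\mathrm{dis}_p(\mu_f).$$ Moreover, if $p<\infty$, then any semi-coupling $\gamma\in\mathcal{SC}(\mu_X,Y)$ with $\mathrm{dis}_p(\gamma)=\mathrm{dis}_p(\mu_f)$ is induced by a function, i.e. $\gamma=\mu_g$ for some function $g:X\to Y$.
   Context: A metric measure space (mm-space) $(X,d_X,\mu_X)$ is a complete separable metric space $(X,d_X)$ with a Borel probability measure $\mu_X$. Let $(Y,d_Y)$ be a complete separable metric space. A semi-coupling of $\mu_X$ and $Y$ is a Borel probability measure $\gamma$ on $X\times Y$ whose first marginal is $\mu_X$, i.e. $(\pi_1)_\#\gamma=\mu_X$ (no condition on the second marginal). The set of semi-couplings is $\mathcal{SC}(\mu_X,Y)$. For $p\in[1,\infty)$ the $p$-distortion of $\gamma$ is $$\mathrm{dis}_p(\gamma)=\frac12\left(\iint |d_X(x,x')-d_Y(y,y')|^p\,d\gamma(x,y)\,d\gamma(x',y')\right)^{1/p}\in[0,\infty],$$ and for $p=\infty$, $$\mathrm{dis}_\infty(\gamma)=\frac12\sup_{(x,y),(x',y')\in\mathrm{supp}(\gamma)}|d_X(x,x')-d_Y(y,y')|.$$ The semi-relaxed Gromov-Wasserstein $p$-distance is $d_{\mathrm{srGW},p}(X,Y)=\inf_{\gamma\in\mathcal{SC}(\mu_X,Y)}\mathrm{dis}_p(\gamma)$.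 For a measurable function $f:X\to Y$, the semi-coupling induced by $f$ is $\mu_f=(\mathrm{id}_X\times f)_\#\mu_X$, where $(\mathrm{id}_X\times f)(x)=(x,f(x))$; for finite $X$, $\mu_f=\sum_{x\in X}\mu_X(\{x\})\,\delta_{(x,f(x))}$. A metric space is proper if its closed bounded subsets are compact. An action of a group $G$ on a metric space $Y$ is cocompact if there is a compact $K\subseteq Y$ whose $G$-translates cover $Y$. *)

(* Defs.v *)
From HB Require Import structures.
From mathcomp Require Import all_boot all_order all_algebra.
From mathcomp Require Import all_classical all_reals all_analysis.

Set Implicit Arguments.
Unset Strict Implicit.
Unset Printing Implicit Defensive.

Import Order.TTheory GRing.Theory Num.Theory.

Local Open Scope classical_set_scope.
Local Open Scope ring_scope.
Local Open Scope ereal_scope.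

(* Nonempty metric spaces. The library's measurable types are pointed, so
   non-emptiness is encoded by a base point; the Borel sigma-algebra, and hence
   every notion below, does not depend on the choice of that point. *)
#[short(type="pmetricType")]
HB.structure Definition PointedMetric (K : numDomainType) :=
  { M of Pointed M & Metric K M }.

(* On a product, [open] refers to the product topology. *)
Notation borel T := (g_sigma_algebraType (@open T)).

Definition separable_space (T : topologicalType) : Prop :=
  exists D : set T, countable D /\ dense D.

Record mmSpace (R : realType) := MMSpace {
  mm_sort :> pmetricType R;
  mm_complete : forall F : set_system mm_sort,
    ProperFilter F -> cauchy F -> cvg F;
  mm_separable : separable_space mm_sort;
  mm_measure : probability (borel mm_sort) R }.

Arguments mm_measure {R} X : rename.

Definition msupport (R : realType) (T : topologicalType) (m : set T -> \bar R) :
    set T :=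
  [set x | forall U : set T, open U -> U x -> 0 < m U].

(* Measures are functions on all subsets but are only meaningful on measurable
   ones, so equality of measures is equality on measurable sets. *)
Definition same_measure d (T : measurableType d) (R : realType)
    (m1 m2 : set T -> \bar R) : Prop :=
  forall A : set T, measurable A -> m1 A = m2 A.

Section semi_relaxed_GW.
Context (R : realType) (X : mmSpace R) (Y : pmetricType R).

Definition semi_coupling (gamma : probability (borel (X * Y)%type) R) : Prop :=
  same_measure (pushforward gamma (fst : borel (X * Y)%type -> borel X))
    (mm_measure X).

Definition distortion (z z' : X * Y) : R :=
  `| mdist z.1 z'.1 - mdist z.2 z'.2 |%R.

(* The value at [-oo] is irrelevant: only exponents at least 1 are used. *)
Definition dis (p : \bar R) (gamma : set (borel (X * Y)%type) -> \bar R) :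
    \bar R :=
  match p with
  | q%:E => (2^-1)%:E *
      (\int[gamma]_z' \int[gamma]_z (distortion z z' `^ q)%:E) `^ q^-1
  | +oo => (2^-1)%:E *
      ereal_sup [set (distortion z z')%:E | z in msupport gamma
                                           & z' in msupport gamma]
  | -oo => 0
  end.

Definition d_srGW (p : \bar R) : \bar R :=
  ereal_inf [set dis p gamma | gamma in semi_coupling].

Definition induced_coupling (f : X -> Y) : set (borel (X * Y)%type) -> \bar R :=
  pushforward (mm_measure X)
    ((fun x => (x, f x)) : borel X -> borel (X * Y)%type).

End semi_relaxed_GW.

Arguments d_srGW {R} X Y p.

(* The library's [bounded_set] is restricted to normed modules. *)
Definition metric_bounded (R : realType) (Y : metricType R) (A : set Y) :
    Prop :=
  exists r : R, forall x y : Y, A x -> A y -> (mdist x y <= r)%R.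

Definition proper_space (R : realType) (Y : metricType R) : Prop :=
  forall A : set Y, closed A -> metric_bounded A -> compact A.

Record isometric_action (R : realType) (Y : metricType R) (G : groupType)
    (act : G -> Y -> Y) : Prop := IsometricAction {
  iact1 : forall y, act 1%g y = y;
  iactM : forall g h y, act (g * h)%g y = act g (act h y);
  iact_isometry : forall g x y, mdist (act g x) (act g y) = mdist x y }.

Definition cocompact (R : realType) (Y : metricType R) (G : groupType)
    (act : G -> Y -> Y) : Prop :=
  exists2 K : set Y, compact K & \bigcup_g (act g @` K) = setT.

(* Main.v *)
(* As X is finite, a semi-coupling gamma is given by its slices
   gamma_x(B) = gamma({x} x B), measures on Y of mass w_x = mu_X{x} > 0. For
   p < oo, (2 dis_p(gamma))^p is a sum over pairs (x, x') of terms bilinear in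
   (gamma_x, gamma_x'). The off-diagonal part is affine in each slice separately,
   so the slices can be replaced one after the other by multiples of Dirac
   masses without increasing it, while the diagonal term of x is
   int int d_Y(y, y')^p dgamma_x dgamma_x, which is nonnegative and vanishes
   only if gamma_x is a multiple of a Dirac mass. Hence a minimizer among maps
   X -> Y is a minimizer among semi-couplings, and every other minimizer is
   induced by a map. For p = oo it suffices to pick, for each x, a point of the
   support of gamma above x. The minimum over maps is attained: by cocompactness
   and invariance the image of a base point may be kept in a fixed compact set,
   and then by properness all values may. *)
Require Import Defs.
From HB Require Import structures.
From mathcomp Require Import all_boot all_order all_algebra.
From mathcomp Require Import all_classical all_reals all_analysis.
From mathcomp Require Import measurable_realfun lra.

Set Implicit Arguments.
Unset Strict Implicit.
Unset Printing Implicit Defensive.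

Import Order.TTheory GRing.Theory Num.Theory.
Import numFieldNormedType.Exports.

Local Open Scope classical_set_scope.
Local Open Scope ring_scope.
Local Open Scope ereal_scope.

(** * Topology of metric spaces: the distance function, compact balls, separability *)

Lemma continuous_mdist (R : realType) (T : topologicalType) (M : metricType R)
    (f g : T -> M) :
  continuous f -> continuous g ->
  continuous (fun t => mdist (f t) (g t) : R).
Proof.
move=> cf cg t; apply/cvgrPdist_lt => e e0.
have e20 : (0 < e / 2)%R by rewrite divr_gt0.
near=> u.
have hf : (mdist (f t) (f u) < e / 2)%R.
  by near: u; exact: (metricType_numDomainType.cvgr_dist_lt (cf t)).
have hg : (mdist (g t) (g u) < e / 2)%R.
  by near: u; exact: (metricType_numDomainType.cvgr_dist_lt (cg t)).
have h1 := metric_triangle (f t) (f u) (g t).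
have h2 := metric_triangle (f u) (g u) (g t).
have h3 := metric_triangle (f u) (f t) (g u).
have h4 := metric_triangle (f t) (g t) (g u).
rewrite (metric_sym (g u) (g t)) in h2.
rewrite (metric_sym (f u) (f t)) in h3.
by rewrite ltr_norml; apply/andP; split; lra.
Unshelve. all: by end_near. Qed.

Lemma closed_mdist_le (R : realType) (M : metricType R) (a : M) (r : R) :
  closed [set y : M | (mdist a y <= r)%R].
Proof.
have cm : continuous (fun y : M => mdist a y : R).
  apply: (@continuous_mdist _ _ _ (fun=> a) id) => t; first exact: cvg_cst.
  exact: cvg_id.
exact: (closed_comp (fun y _ => cm y) (@closed_le R r)).
Qed.

Lemma proper_compact_ball (R : realType) (M : metricType R) (a : M) (r : R) :
  proper_space M -> compact [set y : M | (mdist a y <= r)%R].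
Proof.
move=> pM; apply: pM; first exact: closed_mdist_le.
exists (r + r)%R => x y /= ax ay.
by rewrite (le_trans (metric_triangle x a y))// lerD// metric_sym.
Qed.

(** Each closed ball of integer radius around the base point is compact, so for every [k] it is
    covered by finitely many balls of radius [1/(k+1)]. All the centres together form a countable
    dense set. *)
Lemma proper_separable (R : realType) (M : pmetricType R) :
  proper_space M -> separable_space M.
Proof.
move=> pM; pose B (n : nat) := [set y : M | (mdist point y <= n%:R)%R].
have net (n k : nat) : finite_subset_cover [set: M]
    (fun z => (ball z k.+1%:R^-1)^° : set M) (B n).
  have := @proper_compact_ball _ _ point n%:R pM; rewrite compact_cover; apply.
    by move=> z _; exact: open_interior.
  by move=> z _; exists z => //; apply: nbhsx_ballx; rewrite invr_gt0.
have {net} net n k : exists2 A : set M, countable A &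
    B n `<=` cover A (fun z => (ball z k.+1%:R^-1)^° : set M).
  have [A _ An] := net n k; eexists; last exact: An.
  exact/finite_set_countable/finite_fset.
pose N n k := projT1 (cid2 (net n k)).
have cN n k : countable (N n k) by rewrite /N; case: cid2.
have NP n k : B n `<=` cover (N n k) (fun z => (ball z k.+1%:R^-1)^° : set M).
  by rewrite /N; case: cid2.
exists (\bigcup_(p in [set: nat * nat]) N p.1 p.2); split.
  by apply: bigcup_countable => // p _; exact: cN.
move=> V [x Vx] oV.
have /nbhs_ballP[e /= e0 xeV] : nbhs x V by apply: open_nbhs_nbhs; split.
(* [n] exceeds the distance from the base point to [x], and [k + 1] exceeds [1/e], so the net point
   [z] found near [x] is within [e] of it. *)
pose n := (Num.truncn (mdist point x : R)).+1; pose k := (Num.truncn e^-1).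
have Bx : B n x by rewrite /B/= ltW// truncnS_gt.
have [z /= Nz zx] := NP n k x Bx.
exists z; split; last by exists (n, k).
apply: xeV; apply: ball_sym; apply: le_ball (interior_subset zx).
rewrite -[leRHS]invrK lef_pV2 ?posrE ?invr_gt0//.
by rewrite ltW// truncnS_gt.
Qed.

(** * Borel measurability *)

Lemma measurable_fun_g_sigma_algebra (T U : pointedType) (GT : set (set T))
    (GU : set (set U)) (f : T -> U) :
  (forall V, GU V -> GT (f @^-1` V)) ->
  measurable_fun [set: g_sigma_algebraType GT]
    (f : g_sigma_algebraType GT -> g_sigma_algebraType GU).
Proof.
move=> fG; apply: (@measurability _ _ _ (g_sigma_algebraType GU) _ _ GU) => //.
by move=> _ [V VG <-]; rewrite setTI; apply: sub_sigma_algebra; exact: fG.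
Qed.

Lemma continuous_borel_measurable (R : realType) (T : ptopologicalType)
    (f : T -> R) :
  continuous f -> measurable_fun [set: borel T] (f : borel T -> R).
Proof.
move=> cf; apply: (measurability _ (RGenOpens.measurableE R)) => //.
move=> _ [_ [a [b ->]] <-]; rewrite setTI; apply: sub_sigma_algebra.
by apply: open_comp => // x _; exact: cf.
Qed.

(* Separability is needed because the product of the Borel sigma-algebras may be
   smaller than the Borel sigma-algebra of the product. *)
Lemma measurable_mdist (R : realType) (M : pmetricType R) :
  separable_space M ->
  measurable_fun setT (fun z : borel M * borel M => mdist z.1 z.2 : R).
Proof.
move=> [D [cD dD]].
apply: (measurability _ (RGenInftyO.measurableE R)) => //.
move=> _ [_ [r ->] <-]; rewrite setTI.
(* [d(a, b) < r] holds iff [d(a, q) + d(b, q) < r] for some [q] in the countable dense set [D]; each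
   [E q] involves the two coordinates separately, so it is measurable for the product
   sigma-algebra. *)
pose E q := [set z : borel M * borel M | (mdist z.1 q + mdist z.2 q < r)%R].
rewrite [X in measurable X](_ : _ = \bigcup_(q in D) E q).
  rewrite bigcup_set_type; apply: countable_bigcupT_measurable.
    by rewrite (eq_countable (card_setT _)).
  move=> q; rewrite -[E _]setTI /E.
  have mq : measurable_fun setT (fun y : borel M => mdist y (val q) : R).
    apply: continuous_borel_measurable.
    by apply: (@continuous_mdist _ _ _ id (fun=> _)) => t; [exact: cvg_id|exact: cvg_cst].
  have : measurable_fun setT
     (fun z : borel M * borel M => mdist z.1 (val q) + mdist z.2 (val q) : R)%R.
    by apply: measurable_funD; exact: (measurableT_comp mq).
  move=> /(_ measurableT `]-oo, r[%classic (measurable_itv _)).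
  by under eq_set do rewrite /= in_itv /=.
apply/seteqP; split=> [[a b]|[a b] [q Dq]]; rewrite /E /= in_itv /=; last first.
  by apply: le_lt_trans; rewrite (metric_sym b); exact: metric_triangle.
(* Half of the slack: if [d(b, q) < e], then [d(a, q) + d(b, q) <= d(a, b) + 2 d(b, q) < r]. *)
move=> abr; pose e := ((r - mdist a b) / 2)%R.
have e0 : (0 < e)%R by rewrite divr_gt0// subr_gt0.
have [q [/interior_subset]] : (ball b e)^° `&` D !=set0.
  apply: dD; last exact: open_interior.
  by exists b; exact: nbhsx_ballx.
rewrite ballEmdist /= => bq Dq.
exists q => //=.
have := metric_triangle a b q; move: bq; rewrite /e; lra.
Qed.

Lemma finite_open (R : realType) (M : metricType R) (A : set M) :
  finite_set [set: M] -> open A.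
Proof.
move=> fM; rewrite -[A]setCK openC.
have cl : forall B : set M, finite_set B -> closed B.
  apply/accessible_finite_set_closed.
  exact/hausdorff_accessible/metric_hausdorff.
by apply: cl; apply: sub_finite_set fM => y.
Qed.

(** * Replacing finite measures by Dirac masses *)

Section finite_measures.
Context d (T : measurableType d) (R : realType).

(** A function cannot exceed its mean everywhere: otherwise its difference with the mean would be
    positive everywhere with zero integral, which makes the whole space null. *)
Lemma exists_le_mean (mu : {finite_measure set T -> \bar R}) (h : T -> \bar R) :
  measurable_fun setT h -> (forall x, 0 <= h x) ->
  exists x, mu setT * h x <= \int[mu]_x h x.
Proof.
move=> mh h0; have J0 : 0 <= \int[mu]_x h x by exact: integral_ge0.
have [w0|wN0] := eqVneq (mu setT) 0.
  by exists point; rewrite w0 mul0e.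
apply: contrapT => /forallNP noX.
have {}noX x : \int[mu]_x h x < mu setT * h x.
  by rewrite ltNge; apply/negP; exact: noX.
have wfin : mu setT \is a fin_num by exact: fin_num_measure.
have wgt0 : 0 < mu setT by rewrite lt0e wN0 measure_ge0.
have Jfin : \int[mu]_x h x \is a fin_num.
  by rewrite ge0_fin_numE// (lt_le_trans (noX point))// leey.
set w := fine (mu setT); set J := fine (\int[mu]_x h x).
have wE : mu setT = w%:E by rewrite fineK.
have JE : \int[mu]_x h x = J%:E by rewrite fineK.
have w0 : (0 < w)%R by rewrite -lte_fin -wE.
pose k := (J / w)%R.
have k0 : (0 <= k)%R.
  by rewrite divr_ge0//; [rewrite -lee_fin -JE|exact: ltW].
have hk x : k%:E < h x.
  have := noX x; rewrite JE wE; case: (h x) (h0 x) => [r| |]//= _.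
    by rewrite -EFinM !lte_fin /k ltr_pdivrMr// mulrC.
  by rewrite ltry.
pose g x := h x - k%:E.
have g0 x : 0 <= g x by rewrite sube_ge0// ltW.
have mg : measurable_fun setT g by exact: emeasurable_funB.
have : \int[mu]_x h x = \int[mu]_x (k%:E + g x).
  by apply: eq_integral => x _; rewrite /g addeC subeK.
rewrite ge0_integralD//= integral_cst//= -/w [X in k%:E * X]wE.
rewrite -EFinM divfK ?gt_eqF// JE => JgE.
have gI0 : \int[mu]_x g x = 0.
  by move: JgE; case: (\int[mu]_x g x) => [r| |]//= [] Jr; congr EFin; lra.
have : ae_eq mu setT g (cst 0).
  apply/ae_eq_integral_abs => //.
  by rewrite -[RHS]gI0; apply: eq_integral => x _; rewrite gee0_abs.
move=> [N [mN N0 subN]].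
have : N = setT.
  apply/seteqP; split=> // x _; apply: subN => /= /(_ Logic.I) gx0.
  by have := hk x; rewrite -sube_gt0 -/(g x) gx0 ltxx.
by move=> NT; move: wgt0; rewrite -NT N0 ltxx.
Qed.

Context (I : eqType) (m : I -> {finite_measure set T -> \bar R}).
Variable c : I -> I -> T * T -> \bar R.
Hypothesis mc : forall i j, measurable_fun setT (c i j).
Hypothesis c0 : forall i j z, 0 <= c i j z.
Hypothesis cxx : forall i x, c i i (x, x) = 0.

Let C i j := \int[m i]_x \int[m j]_y c i j (x, y).

(* Replacing [m i] by a Dirac mass turns its interaction with the remaining
   measures into the external field [h], which is there for the induction. *)
Lemma dirac_reduction (s : seq I) (h : I -> T -> \bar R) :
  uniq s -> (forall i, measurable_fun setT (h i)) -> (forall i x, 0 <= h i x) ->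
  exists f : I -> T,
    \sum_(i <- s) m i setT * h i (f i)
    + \sum_(i <- s) \sum_(j <- s) m i setT * (m j setT * c i j (f i, f j))
    + \sum_(i <- s) C i i
    <= \sum_(i <- s) \int[m i]_x h i x + \sum_(i <- s) \sum_(j <- s) C i j.
Proof.
elim: s h => [h _ _ _|a t IH h /= /andP[at_ ut] mh h0].
  by exists (fun=> point); rewrite !big_nil !adde0.
(* The cost [c] need not be symmetric, so [b j] collects both orders of the interaction between [a]
   and [j]. *)
pose b j (z : T * T) := c a j z + c j a (z.2, z.1).
have b0 j z : 0 <= b j z by rewrite adde_ge0.
have msw i j : measurable_fun setT (fun z : T * T => c i j (z.2, z.1)).
  apply: (measurableT_comp (mc i j)).
  by apply: measurable_fun_pair.
have mb j : measurable_fun setT (b j) by apply: emeasurable_funD.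
(* [H x] is the cost per unit mass of placing [m a] at [x] while the measures of [t] are kept. The
   new position of [a] is a point [z] where [H] is at most its mean. *)
pose H x := h a x + \sum_(j <- t) \int[m j]_y b j (x, y).
have mB j : measurable_fun setT (fun x => \int[m j]_y b j (x, y)).
  exact: (measurable_fun_fubini_tonelli_F (m2 := m j)).
have mH : measurable_fun setT H.
  by apply: emeasurable_funD => //; apply: emeasurable_sum => j; exact: mB.
have H0 x : 0 <= H x.
  by rewrite adde_ge0// sume_ge0// => j _; exact: integral_ge0.
have [z Hz] := exists_le_mean (m a) mH H0.
have IHa : \int[m a]_x H x =
    \int[m a]_x h a x + \sum_(j <- t) (C a j + C j a).
  rewrite ge0_integralD//=; last 2 first.
  - by move=> x _; rewrite sume_ge0// => j _; exact: integral_ge0.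
  - by apply: emeasurable_sum => j; exact: mB.
  rewrite ge0_integral_sum//; last by move=> j x _; exact: integral_ge0.
  congr (_ + _); apply: eq_bigr => j _.
  rewrite (eq_integral (fun x => \int[m j]_y c a j (x, y) +
                                 \int[m j]_y c j a (y, x))); last first.
    move=> x _; rewrite ge0_integralD//.
      exact: measurable_fun_pair2.
    exact: measurable_fun_pair1.
  rewrite ge0_integralD//=.
  - congr (_ + _); rewrite /C.
    exact: (fubini_tonelli (m1 := m a) (m2 := m j) _ (msw j a)).
  - by move=> x _; exact: integral_ge0.
  - exact: (measurable_fun_fubini_tonelli_F (m2 := m j)).
  - by move=> x _; exact: integral_ge0.
  - exact: (measurable_fun_fubini_tonelli_F (m2 := m j) _ (msw j a)).
have mbz j : measurable_fun setT (fun y => b j (z, y)).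
  exact: measurable_fun_pair2.
(* Once [m a] is concentrated at [z], its interaction with the remaining measures is an additional
   external field. *)
pose h' j y := h j y + m a setT * b j (z, y).
have wfin i : m i setT \is a fin_num by exact: fin_num_measure.
have [] := IH h' ut.
- move=> j; apply: emeasurable_funD => //.
  by rewrite -(fineK (wfin a)); apply: measurable_funeM.
- by move=> j y; rewrite adde_ge0// mule_ge0.
move=> f0 Hf0.
pose f i := if i == a then z else f0 i; exists f.
have fa : f a = z by rewrite /f eqxx.
have ft i : i \in t -> f i = f0 i.
  by move=> it; rewrite /f; case: eqP => // ia; rewrite -ia it in at_.
have Ih' : \sum_(j <- t) \int[m j]_y h' j y =
    \sum_(j <- t) \int[m j]_y h j y +
    m a setT * \sum_(j <- t) \int[m j]_y b j (z, y).
  rewrite ge0_sume_distrr; last by move=> j _; exact: integral_ge0.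
  rewrite -big_split/=; apply: eq_bigr => j _.
  rewrite ge0_integralD//=; last 2 first.
  - by move=> y _; rewrite mule_ge0.
  - by rewrite -(fineK (wfin a)); apply: measurable_funeM.
  by rewrite ge0_integralZl//.
have Eh' : \sum_(j <- t) m j setT * h' j (f0 j) =
    \sum_(j <- t) m j setT * h j (f j) +
    (\sum_(j <- t) m a setT * (m j setT * c a j (f a, f j)) +
     \sum_(j <- t) m j setT * (m a setT * c j a (f j, f a))).
  rewrite -!big_split/= big_seq [RHS]big_seq; apply: eq_bigr => j jt.
  rewrite fa (ft j jt) /h' ge0_muleDr ?mule_ge0//; congr (_ + _).
  rewrite ge0_muleDr// ge0_muleDr ?mule_ge0//; congr (_ + _).
  by rewrite muleCA.
have Et : \sum_(i <- t) \sum_(j <- t) m i setT * (m j setT * c i j (f0 i, f0 j))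
  = \sum_(i <- t) \sum_(j <- t) m i setT * (m j setT * c i j (f i, f j)).
  rewrite big_seq [RHS]big_seq; apply: eq_bigr => i it.
  rewrite big_seq [RHS]big_seq; apply: eq_bigr => j jt.
  by rewrite !ft.
rewrite Eh' Et Ih' in Hf0.
have sp (F : I -> I -> \bar R) : \sum_(i <- a :: t) \sum_(j <- a :: t) F i j =
    F a a + (\sum_(j <- t) F a j +
             (\sum_(j <- t) F j a + \sum_(i <- t) \sum_(j <- t) F i j)).
  rewrite !big_cons addeA -big_split/=; congr (_ + _).
  by apply: eq_bigr => i _; rewrite big_cons.
(* A Dirac mass has no self-interaction, so the left side has room for [C a a], which the right side
   contains; this produces the diagonal surplus in the bound. *)
rewrite !sp !big_cons cxx !mule0 add0e.
set S1 := \sum_(j <- t) m j setT * h j (f j) in Hf0 *.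
set S2 := \sum_(j <- t) m a setT * (m j setT * c a j (f a, f j)) in Hf0 *.
set S3 := \sum_(j <- t) m j setT * (m a setT * c j a (f j, f a)) in Hf0 *.
set S4 := \sum_(i <- t) \sum_(j <- t) m i setT * _ in Hf0 *.
set S5 := \sum_(i <- t) C i i in Hf0 *.
set K1 := \sum_(i <- t) \int[m i]_x h i x in Hf0 *.
set K2 := \sum_(i <- t) \sum_(j <- t) C i j in Hf0 *.
rewrite big_split/= in IHa.
rewrite fa.
(* Isolate the two sides of the induction hypothesis, then those of [Hz]. *)
rewrite [leLHS](AC ((2*(1*2))*2) ((1*6)*((2*(3*4))*5*7)))/=.
apply: (le_trans (leeD2l _ Hf0)).
rewrite [leRHS](AC (2*(1*(1*2))) ((1*(4*5))*(3*2*6)))/= -IHa.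
rewrite [leLHS](AC (2*3) ((1*4)*(2*3*5)))/=.
apply: leeD2r; move: Hz; rewrite /H ge0_muleDr//.
by rewrite sume_ge0// => j _; exact: integral_ge0.
Qed.

End finite_measures.

(** * Minimization under a cocompact isometric action *)

Lemma compact_mdist_bounded (R : realType) (Y : metricType R) (K : set Y) (a : Y) :
  compact K -> exists D : R, forall y, K y -> (mdist a y <= D)%R.
Proof.
move=> cK; have [->|/set0P K0] := eqVneq K set0; first by exists 0%R.
have cm : continuous (fun y : Y => mdist a y : R).
  by apply: (@continuous_mdist _ _ _ (fun=> a) id) => t; [exact: cvg_cst|exact: cvg_id].
have [|c _ cmax] := compact_EVT_max (f := fun y => mdist a y : R) K0 cK.
  exact: continuous_subspaceT.
by exists (mdist a c) => y Ky; apply: cmax; rewrite inE.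
Qed.

(** Coercivity bounds the diameter of competitive configurations, and invariance lets the value at
    [i0] be moved into [K]. All values then lie in one compact ball, and [F] attains its minimum on
    the Tychonoff product of such balls. *)
Lemma exists_minimizer (R : realType) (I : eqType) (i0 : I) (Y : pmetricType R)
    (G : groupType) (act : G -> Y -> Y) (F : (I -> Y) -> R) :
  proper_space Y -> isometric_action act -> cocompact act ->
  continuous (F : prod_topology (fun _ : I => Y) -> R) ->
  (forall g f, F (fun i => act g (f i)) = F f) ->
  (forall M : R, exists r : R, forall f, (F f <= M)%R ->
     forall i j, (mdist (f i) (f j) <= r)%R) ->
  exists f, forall f', (F f <= F f')%R.
Proof.
move=> pY isoG [K cK KG] cF invF coF.
have [D KD] := compact_mdist_bounded point cK.
have [r Fr] := coF (F (fun=> point)).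
(* [D] reaches every point of [K], and [r] bounds the diameter of any configuration at most as
   costly as the constant one. The absolute value keeps the radius nonnegative, so that the constant
   configuration is admissible. *)
pose A := [set y : Y | (mdist point y <= D + `|r|)%R].
have D0 : (0 <= D)%R.
  have [g _ [k Kk _]] : (\bigcup_g (act g @` K)) point by rewrite KG.
  by rewrite (le_trans _ (KD k Kk))// mdist_ge0.
have cA : compact [set f : prod_topology (fun _ : I => Y) | forall i, A (f i)].
  apply: (tychonoff (T := fun=> Y) (A := fun=> A)) => _; exact: proper_compact_ball.
have A0 : [set f : prod_topology (fun _ : I => Y) | forall i, A (f i)] !=set0.
  by exists (fun=> point) => i; rewrite /A/= mdistxx addr_ge0.
have [|f fA fmin] := compact_EVT_min (f := F : prod_topology (fun _ : I => Y) -> R) A0 cA.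
  exact: continuous_subspaceT.
exists f => f'.
have fp : (F f <= F (fun=> point))%R.
  by apply: fmin; rewrite inE => i; rewrite /A/= mdistxx addr_ge0.
(* A configuration more expensive than the constant one is beaten at once; any other is translated
   so that its value at [i0] becomes [k] in [K]. *)
have [f'M|/ltW] := leP (F f') (F (fun=> point)); last exact: le_trans.
have [g _ [k Kk kE]] : (\bigcup_g (act g @` K)) (f' i0) by rewrite KG.
rewrite -(invF g^-1%g f'); apply: fmin; rewrite inE /A => i /=.
have gk : act g^-1%g (f' i0) = k.
  by rewrite -kE -(iactM isoG) mulVg (iact1 isoG).
apply: le_trans (metric_triangle _ k _) _; apply: lerD; first exact: KD.
rewrite -gk (iact_isometry isoG); apply: le_trans (ler_norm _).
exact: Fr.
Qed.

(** Away from zero the power is differentiable; at zero, [|y| < e^(1/q)] gives [|y|^q < e]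
    directly. *)
Lemma continuous_powR_norm (R : realType) (q : R) : (0 < q)%R ->
  continuous (fun x : R => (`|x| `^ q)%R).
Proof.
move=> q0 x; have [->|x0] := eqVneq x 0%R.
  apply/cvgrPdist_lt => e e0; rewrite normr0 powR0 ?gt_eqF//.
  near=> y; rewrite sub0r normrN ger0_norm ?powR_ge0//.
  have : (`|y| < e `^ q^-1)%R.
    near: y; apply/nbhs_ballP; exists (e `^ q^-1)%R; first exact: powR_gt0.
    by move=> y; rewrite /ball/= sub0r normrN.
  move=> ye; have := gt0_ltr_powR q0 (normr_ge0 _) (powR_ge0 _ _) ye.
  by rewrite -powRrM mulVf ?gt_eqF// powRr1// ltW.
apply: (@continuous_comp _ _ _ (fun x : R => `|x|%R) (fun x => x `^ q)%R).
  exact: norm_continuous.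
apply: differentiable_continuous; apply/derivable1_diffP.
apply: ex_derive; apply: is_derive1_powR; by rewrite normr_gt0.
Unshelve. all: by end_near. Qed.

(** * Disintegration of a coupling into its slices *)

Section slices.
Context (R : realType) (X Y : pmetricType R).

Local Notation BX := (borel X).
Local Notation BY := (borel Y).
Local Notation BZ := (borel (X * Y)%type).

Lemma measurable_borel_set1 (x : X) : measurable ([set x] : set BX).
Proof.
rewrite -[X in measurable X]setCK; apply: measurableC; apply: sub_sigma_algebra.
rewrite openC; apply: accessible_closed_set1.
exact/hausdorff_accessible/metric_hausdorff.
Qed.

Lemma measurable_borel_fst : measurable_fun setT (fst : BZ -> BX).
Proof.
apply: measurable_fun_g_sigma_algebra => V oV.
by apply: open_comp => // z _; exact: cvg_fst.
Qed.

Lemma measurable_borel_snd : measurable_fun setT (snd : BZ -> BY).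
Proof.
apply: measurable_fun_g_sigma_algebra => V oV.
by apply: open_comp => // z _; exact: cvg_snd.
Qed.

Lemma continuous_section (x : X) : continuous (fun y : Y => (x, y)).
Proof. by move=> y; apply: cvg_pair; [exact: cvg_cst|exact: cvg_id]. Qed.

Lemma measurable_borel_section (x : X) :
  measurable_fun setT ((fun y => (x, y)) : BY -> BZ).
Proof.
apply: measurable_fun_g_sigma_algebra => V oV.
by apply: open_comp => // y _; exact: continuous_section.
Qed.

Lemma measurable_fiber (x : X) (B : set Y) : measurable (B : set BY) ->
  measurable ([set x] `*` B : set BZ).
Proof.
move=> mB; rewrite (_ : _ `*` _ = (fst @^-1` [set x]) `&` (snd @^-1` B))//.
apply: measurableI.
  rewrite -[X in measurable X]setTI.
  exact: (measurable_borel_fst measurableT (measurable_borel_set1 x)).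
rewrite -[X in measurable X]setTI.
exact: (measurable_borel_snd measurableT mB).
Qed.

Definition slice (gamma : probability BZ R) (x : X) : set BY -> \bar R :=
  fun B => gamma ([set x] `*` B).

Section slice_measure.
Variables (gamma : probability BZ R) (x : X).

Let slice0 : slice gamma x set0 = 0.
Proof. by rewrite /slice setX0 measure0. Qed.

Let slice_ge0 B : 0 <= slice gamma x B.
Proof. exact: measure_ge0. Qed.

Let slice_sigma_additive : semi_sigma_additive (slice gamma x).
Proof.
move=> F mF tF mUF; rewrite /slice.
have -> : [set x] `*` \bigcup_n F n = \bigcup_n ([set x] `*` F n).
  apply/seteqP; split => [[a b] /= [-> [n _ Fnb]]|[a b] [n _ /= [-> Fnb]]].
    by exists n.
  by split => //; exists n.
apply: measure_semi_sigma_additive.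
- by move=> n; exact: measurable_fiber.
- apply/trivIsetP => i j _ _ ij; apply/seteqP; split => // -[a b] /= [[_ Fi] [_ Fj]].
  move/trivIsetP : tF => /(_ i j Logic.I Logic.I ij) Fij.
  by suff : (F i `&` F j) b by rewrite Fij.
- by apply: bigcup_measurable => n _; exact: measurable_fiber.
Qed.

HB.instance Definition _ := isMeasure.Build _ _ _ (slice gamma x)
  slice0 slice_ge0 slice_sigma_additive.

Let slice_finite : fin_num_fun (slice gamma x).
Proof. by move=> B mB; apply: fin_num_measure; exact: measurable_fiber. Qed.

HB.instance Definition _ := Measure_isFinite.Build _ _ _ (slice gamma x)
  slice_finite.

End slice_measure.

(** On subsets of the fibre above [x], [gamma] agrees with the pushforward of the slice under
    [y |-> (x, y)], so this is a change of variables. *)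
Lemma integral_slice (gamma : probability BZ R) (x : X) (g : BZ -> \bar R) :
  measurable_fun setT g -> (forall z, 0 <= g z) ->
  \int[gamma]_(z in [set x] `*` setT) g z = \int[slice gamma x]_y g (x, y).
Proof.
move=> mg g0; set S : set BZ := [set x] `*` setT.
have mS : measurable (S : set BZ) by exact: measurable_fiber.
have mgS : measurable_fun S g by exact: measurable_funS mg.
have := ge0_integral_pushforward (measurable_borel_section x)
  (slice gamma x) mS mgS (fun z _ => g0 z).
have -> : (fun y : BY => (x, y)) @^-1` S = setT by apply/seteqP; split.
move=> <-.
apply: eq_measure_integral; first exact: measurable_borel_section.
move=> ? A mA AS; rewrite /pushforward /slice.
congr (gamma _); apply/seteqP; split => [[a b] Aab|[a b] /= [-> ]//].
by have [/= ax _] := AS _ Aab; split => //=; rewrite -ax.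
Qed.

Lemma integral_sum_slices (s : seq X) (gamma : probability BZ R)
    (g : BZ -> \bar R) : uniq s -> (forall x, x \in s) ->
  measurable_fun setT g -> (forall z, 0 <= g z) ->
  \int[gamma]_z g z = \sum_(x <- s) \int[slice gamma x]_y g (x, y).
Proof.
move=> us sX mg g0.
under eq_bigr do rewrite -integral_slice//.
rewrite -ge0_integral_bigsetU//; last 3 first.
- by move=> x; exact: measurable_fiber.
- apply/trivIsetP => i j _ _ /eqP ij; apply/seteqP; split => // -[a b] /=.
  by move=> [[-> _] [/ij]].
- exact: measurable_funS mg.
congr integral; apply/esym/seteqP; split=> // -[a b] _.
by rewrite -bigcup_seq; exists a => //=; exact: sX.
Qed.

Lemma energy_slices (s : seq X) (gamma : probability BZ R)
    (c : BZ * BZ -> \bar R) : uniq s -> (forall x, x \in s) ->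
  measurable_fun setT c -> (forall z, 0 <= c z) ->
  \int[gamma]_z' \int[gamma]_z c (z, z') =
  \sum_(i <- s) \sum_(j <- s)
    \int[slice gamma i]_y' \int[slice gamma j]_y c ((j, y), (i, y')).
Proof.
move=> us sX mc c0.
have mcj (j : X) : measurable_fun setT (fun u : BZ * BY => c ((j, u.2), u.1)).
  apply: (measurableT_comp mc); apply: measurable_fun_pair => //.
  exact: (measurableT_comp (measurable_borel_section j)).
have mIj (j : X) : measurable_fun setT
    (fun z' => \int[slice gamma j]_y c ((j, y), z')).
  exact: (measurable_fun_fubini_tonelli_F (m2 := slice gamma j) _ (mcj j)).
under eq_integral => z' _.
  rewrite (integral_sum_slices gamma us sX) //; first over.
  exact: measurable_fun_pair1.
rewrite (integral_sum_slices gamma us sX); last 2 first.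
- by apply: emeasurable_sum => j.
- by move=> z; rewrite sume_ge0// => j _; exact: integral_ge0.
apply: eq_bigr => i _; rewrite ge0_integral_sum//; last first.
  by move=> j y _; exact: integral_ge0.
by move=> j; exact: (measurableT_comp (mIj j) (measurable_borel_section i)).
Qed.

End slices.

(** * Couplings induced by maps from a finite space *)

Section finite_source.
Context (R : realType) (X : mmSpace R) (Y : pmetricType R).
Hypothesis finX : finite_set [set: X].

Local Notation mu := (mm_measure X).
Local Notation BZ := (borel (X * Y)%type).

Lemma measurable_finite_borel (A : set X) : measurable (A : set (borel X)).
Proof. by apply: sub_sigma_algebra; exact: finite_open. Qed.

Lemma measurable_fun_finite_borel d (U : measurableType d) (f : X -> U) :
  measurable_fun setT (f : borel X -> U).
Proof. by move=> _ V _; exact: measurable_finite_borel. Qed.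

Lemma integral_finite_borel (s : seq X) (g : X -> \bar R) :
  uniq s -> (forall x, x \in s) -> (forall x, 0 <= g x) ->
  \int[mu]_x g x = \sum_(x <- s) mu [set x] * g x.
Proof.
move=> us sX g0.
rewrite (_ : setT = \big[setU/set0]_(x <- s) [set x]); last first.
  apply/esym/seteqP; split=> // x _.
  by rewrite -bigcup_seq; exists x => //=; exact: sX.
rewrite ge0_integral_bigsetU//.
- apply: eq_bigr => x _; rewrite (eq_integral (cst (g x))).
    by rewrite integral_cst 1?muleC//; exact: measurable_finite_borel.
  by move=> y; rewrite inE /= => ->.
- by move=> x; exact: measurable_finite_borel.
- by apply/trivIsetP => i j _ _ /eqP ij; apply/seteqP; split => // x /= [->].
- by apply: measurable_funTS; exact: measurable_fun_finite_borel.
Qed.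

(** [induced_coupling f] is a bare set function, while semi-couplings are bundled probabilities;
    this supplies the bundled version. Every map out of the finite space is Borel, so its graph map
    has a distribution. *)
Lemma induced_couplingP (f : X -> Y) : exists gamma : probability BZ R,
  semi_coupling gamma /\ gamma = induced_coupling f :> (set BZ -> \bar R).
Proof.
have mf : measurable_fun setT ((fun x => (x, f x)) : borel X -> BZ).
  exact: measurable_fun_finite_borel.
pose phi := (fun x => (x, f x)) : borel X -> BZ.
pose mphi := isMeasurableFun.Build _ _ _ _ phi mf.
pose phiM : {mfun borel X >-> BZ} := HB.pack phi mphi.
by exists (distribution mu phiM).
Qed.

Lemma energy_induced (s : seq X) (f : X -> Y) (c : BZ * BZ -> \bar R) :
  uniq s -> (forall x, x \in s) ->
  measurable_fun setT c -> (forall z, 0 <= c z) ->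
  \int[induced_coupling f]_z' \int[induced_coupling f]_z c (z, z') =
  \sum_(i <- s) \sum_(j <- s)
    mu [set i] * (mu [set j] * c ((j, f j), (i, f i))).
Proof.
move=> us sX mc c0.
have mf : measurable_fun setT ((fun x => (x, f x)) : borel X -> BZ).
  exact: measurable_fun_finite_borel.
have inner z' : \int[induced_coupling f]_z c (z, z') =
    \sum_(j <- s) mu [set j] * c ((j, f j), z').
  rewrite (ge0_integral_pushforward mf) ?preimage_setT//.
    by rewrite (integral_finite_borel us sX)//= => x; exact: c0.
  exact: measurable_fun_pair1.
under eq_integral do rewrite inner.
rewrite (ge0_integral_pushforward mf) ?preimage_setT//; last 2 first.
- apply: emeasurable_sum => j.
  have fw : mu [set j] \is a fin_num.
    by apply: fin_num_measure; exact: measurable_finite_borel.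
  rewrite -(fineK fw); apply: measurable_funeM.
  exact: (@measurable_fun_pair2 _ _ _ BZ BZ _ c (j, f j) mc).
- by move=> z _; rewrite sume_ge0// => j _; rewrite mule_ge0.
rewrite (integral_finite_borel us sX)/=; last first.
  by move=> x; rewrite sume_ge0// => j _; rewrite mule_ge0.
apply: eq_bigr => i _; rewrite ge0_sume_distrr// => j _.
by rewrite mule_ge0.
Qed.

End finite_source.

(** * Supports of semi-couplings and of induced couplings *)

(** By compactness finitely many null open sets cover each ball of integer radius, and these
    countably many null balls exhaust the space. *)
Lemma negligible_setT_locally (R : realType) (Y : pmetricType R)
    (m : {measure set (borel Y) -> \bar R}) : proper_space Y ->
  (forall y : Y, exists V : set Y, [/\ open V, V y & m V = 0]) -> m setT = 0.
Proof.
move=> pY locN; pose V y := projT1 (cid (locN y)).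
have oV y : open (V y) by rewrite /V; case: cid => ? [].
have Vy y : V y y by rewrite /V; case: cid => ? [].
have mV y : measurable (V y : set (borel Y)) by apply: sub_sigma_algebra; exact: oV.
have V0 y : m (V y) = 0 by rewrite /V; case: cid => ? [].
pose B (n : nat) := [set y : Y | (mdist point y <= n%:R)%R].
have mB n : measurable (B n : set (borel Y)).
  rewrite -[B n]setCK; apply: measurableC; apply: sub_sigma_algebra.
  by rewrite openC; exact: closed_mdist_le.
have B0 n : m (B n) = 0.
  have := proper_compact_ball (a := point) (r := n%:R) pY.
  rewrite compact_cover => /(_ Y setT V (fun y _ => oV y))[|D' _ BD].
    by move=> y _; exists y.
  apply/eqP; rewrite eq_le measure_ge0 andbT.
  rewrite (le_trans (content_sub_fsum m _ _ _ BD))//=; last by rewrite fsbig1.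
  exact: mB.
have mUB : measurable (\bigcup_n B n : set (borel Y)).
  by apply: bigcup_measurable => n _; exact: mB.
have nUB : m.-negligible (\bigcup_n B n).
  by apply: negligible_bigcup => n; exact/(negligibleP m (mB n))/B0.
rewrite -(measure_negligible mUB nUB); congr (m _).
apply/esym/seteqP; split => // y _; exists (Num.truncn (mdist point y)).+1 => //.
by rewrite /B /= ltW// truncnS_gt.
Qed.

Section support.
Context (R : realType) (X : mmSpace R) (Y : pmetricType R).
Hypothesis finX : finite_set [set: X].
Hypothesis fullX : msupport (mm_measure X) = [set: X].

Lemma measure_set1_gt0 (x : X) : 0 < mm_measure X [set x].
Proof.
have : msupport (mm_measure X) x by rewrite fullX.
by apply => //; exact: finite_open.
Qed.

Lemma semi_coupling_slice (gamma : probability (borel (X * Y)%type) R) (x : X) :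
  semi_coupling gamma -> slice gamma x setT = mm_measure X [set x].
Proof.
move=> scg; rewrite -scg; last exact: measurable_borel_set1.
rewrite /slice/= /pushforward; congr (gamma _).
by apply/seteqP; split => [[a b] []|[a b] /= ->].
Qed.

(** If no point above [x] were in the support, each [(x, y)] would have a null open neighbourhood.
    Its section would be open and null for the slice, so the slice would vanish, although its mass
    [mu {x}] is positive. *)
Lemma msupport_fiber (gamma : probability (borel (X * Y)%type) R) (x : X) :
  proper_space Y -> semi_coupling gamma ->
  exists y, msupport gamma (x, y).
Proof.
move=> pY scg; apply: contrapT => /forallNP noy.
have := measure_set1_gt0 x; rewrite -(semi_coupling_slice x scg).
rewrite (@negligible_setT_locally _ _ (slice gamma x)) ?ltxx// => y.
have [U /not_implyP[oU /not_implyP[Uxy U0]]] := (existsNP _).2 (noy y).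
exists [set y' | U (x, y')]; split => //.
  by apply: open_comp oU => // y' _; exact: continuous_section.
apply/eqP; rewrite eq_le measure_ge0 andbT leNgt; apply/negP => sU.
apply: U0; apply: lt_le_trans sU _.
rewrite -[leLHS]/(gamma ([set x] `*` [set y' | U (x, y')])).
rewrite le_measure ?inE//.
- apply: measurable_fiber; apply: sub_sigma_algebra.
  by apply: open_comp oU => // y' _; exact: continuous_section.
- exact: sub_sigma_algebra.
- by move=> [a b] /= [-> ].
Qed.

Lemma msupport_induced (f : X -> Y) (z : X * Y) :
  msupport (induced_coupling f : set (X * Y) -> \bar R) z -> z.2 = f z.1.
Proof.
move=> zs; apply: contrapT => zf.
(* Singletons of the finite space are open, so [U] is an open neighbourhood of [z] that misses the
   graph of [f]. *)
pose U : set (X * Y) := (fst @^-1` [set z.1]) `&` (snd @^-1` ~` [set f z.1]).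
have oU : open U.
  apply: openI; apply: open_comp.
  - by move=> u _; exact: cvg_fst.
  - exact: finite_open.
  - by move=> u _; exact: cvg_snd.
  - rewrite openC; apply: accessible_closed_set1.
    exact/hausdorff_accessible/metric_hausdorff.
have := zs _ oU; rewrite /induced_coupling /pushforward.
rewrite (_ : _ @^-1` U = set0) ?measure0 ?ltxx.
  by move=> /(_ (conj erefl zf)).
by apply/seteqP; split => // a [/= az]; apply; rewrite /= az.
Qed.

End support.

(** * Comparing semi-couplings with maps *)

Section minimizers.
Context (R : realType) (X : mmSpace R) (Y : pmetricType R).
Hypothesis finX : finite_set [set: X].
Hypothesis fullX : msupport (mm_measure X) = [set: X].
Hypothesis properY : proper_space Y.

Local Notation mu := (mm_measure X).
Local Notation BZ := (borel (X * Y)%type).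

Lemma exists_enum : exists s : seq X, uniq s /\ forall x, x \in s.
Proof.
have /finite_seqP[s sE] := finX; exists (undup s); split; first exact: undup_uniq.
by move=> x; rewrite mem_undup; have : [set: X] x by []; rewrite sE.
Qed.

Lemma measurable_distortion :
  measurable_fun setT (fun u : BZ * BZ => distortion u.1 u.2).
Proof.
have p1 : measurable_fun setT (fst : BZ * BZ -> BZ) by exact: measurable_fst.
have p2 : measurable_fun setT (snd : BZ * BZ -> BZ) by exact: measurable_snd.
have fX := @measurable_borel_fst R X Y; have sY := @measurable_borel_snd R X Y.
have pX := measurable_fun_pair (measurableT_comp fX p1) (measurableT_comp fX p2).
have pY := measurable_fun_pair (measurableT_comp sY p1) (measurableT_comp sY p2).
have mX := measurableT_comp (measurable_mdist (@mm_separable R X)) pX.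
have mY := measurableT_comp (measurable_mdist (proper_separable properY)) pY.
exact: (measurableT_comp (@normr_measurable R setT) (measurable_funB mX mY)).
Qed.

Lemma continuous_distortion_graph (i j : X) :
  continuous (fun f : prod_topology (fun _ : X => Y) =>
    distortion (j, f j) (i, f i) : R).
Proof.
have cp k : continuous (fun f : prod_topology (fun _ : X => Y) => f k).
  exact: (@proj_continuous X (fun=> Y) k).
move=> f; rewrite /distortion /=.
have cm := continuous_mdist (cp j) (cp i).
exact: (cvg_norm (cvgB (cvg_cst (mdist j i : R)) (cm f))).
Qed.

Lemma continuous_distortion_powR (i j : X) (a b q : R) : (0 < q)%R ->
  continuous (fun f : prod_topology (fun _ : X => Y) =>
    a * (b * distortion (j, f j) (i, f i) `^ q) : R)%R.
Proof.
move=> q0 f; have := @continuous_distortion_graph i j f.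
rewrite /continuous_at; set D := fun f : prod_topology _ => distortion _ _.
rewrite -/(D f) => cD.
(* The distortion is nonnegative, so absolute values can be inserted to apply
   [continuous_powR_norm]. *)
have -> : (fun g : prod_topology (fun _ : X => Y) => a * (b * D g `^ q))%R =
    (fun g => a * (b * `|D g| `^ q))%R.
  by apply/funext => g; rewrite ger0_norm// normr_ge0.
have -> : (a * (b * D f `^ q) = a * (b * `|D f| `^ q))%R.
  by rewrite (ger0_norm (normr_ge0 _)).
have cq := cvg_comp _ _ cD (@continuous_powR_norm R q q0 (D f)).
exact: (cvgM (cvg_cst a) (cvgM (cvg_cst b) cq)).
Qed.

Lemma distortion_act (G : groupType) (act : G -> Y -> Y) (g : G) (f : X -> Y) i j :
  isometric_action act ->
  distortion (j, act g (f j)) (i, act g (f i)) = distortion (j, f j) (i, f i) :> R.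
Proof. by move=> iso; rewrite /distortion /= (iact_isometry iso). Qed.

Lemma mdist_le_distortion (z z' : X * Y) :
  (mdist z.2 z'.2 <= distortion z z' + mdist z.1 z'.1 :> R)%R.
Proof.
rewrite /distortion -lerBlDr -[leLHS]opprB; apply: le_trans (ler_norm _) _.
by rewrite normrN.
Qed.

Lemma distortionxx (z : X * Y) : distortion z z = 0%R :> R.
Proof. by rewrite /distortion !mdistxx subrr normr0. Qed.

(** For [q > 0] this is [(2 dis_q)^q], the form that splits into a finite sum over pairs of
    slices. *)
Definition energy (q : R) (gamma : set BZ -> \bar R) : \bar R :=
  \int[gamma]_z' \int[gamma]_z (distortion z z' `^ q)%:E.

(** The sum over [s] is the diagonal surplus from [dirac_reduction]. It is kept because a
    semi-coupling of minimal energy must make it vanish, once the finite energy of [f] is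
    cancelled. *)
Lemma energy_minimizer (s : seq X) (G : groupType) (act : G -> Y -> Y) (q : R) :
  uniq s -> (forall x, x \in s) ->
  isometric_action act -> cocompact act -> (1 <= q)%R ->
  exists f : X -> Y, energy q (induced_coupling f) \is a fin_num /\
    forall gamma : probability BZ R, semi_coupling gamma ->
      energy q (induced_coupling f) +
        \sum_(x <- s) \int[slice gamma x]_y' \int[slice gamma x]_y
          (mdist y y' `^ q)%:E <= energy q gamma.
Proof.
move=> us sX isoG cocG q1.
have q0 : (0 < q)%R by exact: lt_le_trans q1.
pose w x := fine (mu [set x]).
have wE x : mu [set x] = (w x)%:E.
  by rewrite fineK//; apply: fin_num_measure; exact: measurable_borel_set1.
have w0 x : (0 < w x)%R by rewrite -lte_fin -wE; exact: measure_set1_gt0.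
pose c (u : BZ * BZ) : \bar R := (distortion u.1 u.2 `^ q)%:E.
have c0 u : 0 <= c u by rewrite lee_fin powR_ge0.
have mc : measurable_fun setT c.
  apply/measurable_EFinP; apply: (measurableT_comp (measurable_powR q)).
  exact: measurable_distortion.
pose F (f : X -> Y) : R := (\sum_(i <- s) \sum_(j <- s)
   w i * (w j * distortion (j, f j) (i, f i) `^ q))%R.
have EF f : energy q (induced_coupling f) = (F f)%:E.
  rewrite /energy (energy_induced finX f us sX mc c0) /F -sumEFin.
  apply: eq_bigr => i _; rewrite -sumEFin; apply: eq_bigr => j _.
  by rewrite !wE.
have [| | |f fmin] := exists_minimizer (F := F) (point : X) properY isoG cocG.
- apply: continuous_big => [|i _]; first exact: add_continuous.
  apply: continuous_big => [|j _]; first exact: add_continuous.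
  exact: (continuous_distortion_powR q0).
- by move=> g f; rewrite /F; apply: eq_bigr => i _; apply: eq_bigr => j _;
    rewrite (distortion_act _ _ _ _ isoG).
- move=> M.
  (* All weights are positive, so [F f <= M] bounds each term and hence each distortion by
     [(M / (w i * w j))^(1/q)]; adding the distance in [X] bounds the distance in [Y]. *)
  pose r i j := ((M / (w i * w j)) `^ q^-1 + mdist j i)%R.
  have r0 i j : (0 <= r i j)%R by rewrite addr_ge0 ?powR_ge0 ?mdist_ge0.
  exists (\sum_(i <- s) \sum_(j <- s) r i j)%R => f fM i j.
  have tge0 k l : (0 <= w k * (w l * distortion (l, f l) (k, f k) `^ q))%R.
    by apply: mulr_ge0; [exact: ltW|apply: mulr_ge0; [exact: ltW|exact: powR_ge0]].
  have tM : (w j * (w i * distortion (i, f i) (j, f j) `^ q) <= M)%R.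
    apply: le_trans fM; rewrite /F (bigD1_seq j)//= (bigD1_seq i)//= -addrA lerDl.
    by rewrite addr_ge0// sumr_ge0// => k _; rewrite ?sumr_ge0.
  have rij : (mdist (f i) (f j) <= r j i)%R.
    apply: le_trans (mdist_le_distortion (i, f i) (j, f j)) _; rewrite /r lerD2r.
    rewrite -[leLHS]powRr1 ?normr_ge0// -(mulfV (lt0r_neq0 q0)) powRrM.
    have ww : (0 < w j * w i)%R by exact: mulr_gt0.
    have dM : (distortion (i, f i) (j, f j) `^ q <= M / (w j * w i))%R.
      by rewrite ler_pdivlMr// mulrC -mulrA.
    apply: ge0_ler_powR => //.
    - by rewrite invr_ge0 ltW.
    - by rewrite nnegrE powR_ge0.
    - by rewrite nnegrE (le_trans _ dM)// powR_ge0.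
  apply: le_trans rij _.
  rewrite (bigD1_seq j)//= (bigD1_seq i)//= -addrA lerDl.
  by rewrite addr_ge0// sumr_ge0// => k _; rewrite ?sumr_ge0.
exists f; split; first by rewrite EF.
move=> gamma scg.
have mcc (i j : X) : measurable_fun setT
    (fun u : borel Y * borel Y => c ((j, u.2), (i, u.1))).
  have s1 := measurableT_comp (@measurable_borel_section R X Y j)
    (@measurable_snd _ _ (borel Y) (borel Y)).
  have s2 := measurableT_comp (@measurable_borel_section R X Y i)
    (@measurable_fst _ _ (borel Y) (borel Y)).
  exact: (measurableT_comp mc (measurable_fun_pair s1 s2)).
have cxx i (y : borel Y) : c ((i, y), (i, y)) = 0.
  by rewrite /c distortionxx powR0// gt_eqF.
have mcst : measurable_fun setT (cst 0 : borel Y -> \bar R) by [].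
have sw x : (slice gamma x : {finite_measure set (borel Y) -> \bar R}) setT
    = (w x)%:E by rewrite -wE -(semi_coupling_slice x scg).
have S0 : \sum_(i <- s) \int[slice gamma i]_x (cst 0 : borel Y -> \bar R) x = 0.
  by rewrite big1// => i _; rewrite integral0.
(* The reduction starts without external field. *)
have [h] := @dirac_reduction _ _ R X (slice gamma)
   (fun i j u => c ((j, u.2), (i, u.1))) mcc (fun i j u => c0 _) cxx s
   (fun _ => cst 0) us (fun _ => mcst) (fun _ _ => lexx 0).
rewrite S0 -(energy_slices gamma us sX mc c0).
rewrite big1; last by move=> i _; rewrite mule0.
rewrite !add0e; apply: le_trans; apply: leeD.
  apply: (@le_trans _ _ (F h)%:E); first by rewrite EF lee_fin.
  rewrite le_eqVlt; apply/orP; left; apply/eqP.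
  rewrite /F -sumEFin; apply: eq_bigr => i _; rewrite -sumEFin; apply: eq_bigr => j _.
  by rewrite !sw.
(* Above a single point the distance in [X] is zero, so the distortion is the distance in [Y]. *)
rewrite le_eqVlt; apply/orP; left; apply/eqP; apply: eq_bigr => i _.
apply: eq_integral => y' _; apply: eq_integral => y _.
by rewrite /c /distortion /= mdistxx sub0r normrN ger0_norm ?mdist_ge0// metric_sym.
Qed.

(** The inner integral vanishes for almost every [y'], hence for some [y'] because the slice is
    nonzero; for that [y'], almost every [y] is at distance zero from it. *)
Lemma slice_concentrated (gamma : probability BZ R) (x : X) (q : R) :
  (0 < q)%R -> slice gamma x setT != 0 ->
  \int[slice gamma x]_y' \int[slice gamma x]_y (mdist y y' `^ q)%:E = 0 ->
  exists y, slice gamma x (~` [set y]) = 0.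
Proof.
move=> q0 sN0 I0.
have md : measurable_fun setT
    (fun u : borel Y * borel Y => (mdist u.2 u.1 `^ q)%:E).
  apply/measurable_EFinP; apply: (measurableT_comp (measurable_powR q)).
  have sw := measurable_fun_pair (@measurable_snd _ _ (borel Y) (borel Y))
    (@measurable_fst _ _ (borel Y) (borel Y)).
  exact: (measurableT_comp (measurable_mdist (proper_separable properY)) sw).
have d0 (u : borel Y * borel Y) : 0 <= (mdist u.2 u.1 `^ q)%:E.
  by rewrite lee_fin powR_ge0.
have mI := measurable_fun_fubini_tonelli_F (m2 := slice gamma x) _ md d0.
have : ae_eq (slice gamma x) setT (fubini_F (slice gamma x)
    (fun u : borel Y * borel Y => (mdist u.2 u.1 `^ q)%:E)) (cst 0).
  apply/ae_eq_integral_abs => //; rewrite -[RHS]I0; apply: eq_integral => y _.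
  by rewrite gee0_abs//; apply: integral_ge0 => z _; exact: (d0 (y, z)).
move=> [N [mN N0 subN]].
have [y Iy] : exists y', \int[slice gamma x]_y (mdist y y' `^ q)%:E = 0.
  apply: contrapT => /forallNP nI; move/eqP: sN0; apply.
  rewrite -N0; congr (slice _ _ _); apply/esym/seteqP; split => // y _.
  by apply: subN => /= /(_ Logic.I); exact: nI.
exists y.
have my : measurable_fun setT (fun z : borel Y => (mdist z y `^ q)%:E).
  exact: (@measurable_fun_pair2 _ _ _ (borel Y) (borel Y) _ _ y md).
have : ae_eq (slice gamma x) setT (fun z : borel Y => (mdist z y `^ q)%:E) (cst 0).
  apply/ae_eq_integral_abs => //; rewrite -[RHS]Iy; apply: eq_integral => z _.
  by rewrite gee0_abs// lee_fin powR_ge0.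
move=> [N' [mN' N'0 subN']].
apply/(measure_negligible (measurableC (@measurable_borel_set1 R Y y))).
exists N'; split => // z /= zy; apply: subN' => /= /(_ Logic.I) [] /eqP.
rewrite powR_eq0 (gt_eqF q0) andbT => /eqP /mdist_positivity; exact: zy.
Qed.

(** On the slice above [x] the indicator of [A] is almost everywhere equal to its value at
    [(x, g x)], so [gamma A] becomes a sum of weights over the points whose graph point lies in
    [A]. *)
Lemma same_measure_induced (s : seq X) (gamma : probability BZ R) (g : X -> Y) :
  uniq s -> (forall x, x \in s) -> semi_coupling gamma ->
  (forall x, slice gamma x (~` [set g x]) = 0) ->
  same_measure gamma (induced_coupling g).
Proof.
move=> us sX scg sg A mA.
have mA1 : measurable_fun setT (fun z : BZ => (\1_A z)%:E : \bar R).
  exact/measurable_EFinP/measurable_indic.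
have A0 (z : BZ) : 0 <= (\1_A z)%:E :> \bar R by rewrite lee_fin.
have -> : gamma A = \int[gamma]_z (\1_A z)%:E by rewrite integral_indic// setIT.
rewrite (integral_sum_slices gamma us sX)//.
have mP : measurable ([set x | A (x, g x)] : set (borel X)).
  exact: measurable_finite_borel.
have -> : induced_coupling g A = \int[mu]_x (\1_A (x, g x))%:E.
  rewrite -[LHS]/(mu [set x | A (x, g x)]) -[X in mu X]setIT -integral_indic//.
rewrite (integral_finite_borel finX us sX)//; apply: eq_bigr => x _.
rewrite (ae_eq_integral (cst (\1_A (x, g x))%:E))//.
- by rewrite integral_cst//= (semi_coupling_slice _ scg) muleC.
- exact: (measurableT_comp mA1 (@measurable_borel_section R X Y x)).
exists (~` [set g x]); split.
- exact: (measurableC (@measurable_borel_set1 R Y (g x))).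
- exact: sg.
- by move=> y /=; apply: contra_not => -> _.
Qed.

Lemma energy_ge0 (q : R) (gamma : probability BZ R) : 0 <= energy q gamma.
Proof.
apply: integral_ge0 => z _; apply: integral_ge0 => z' _.
by rewrite lee_fin powR_ge0.
Qed.

Lemma eq_dis_energy (q : R) (m1 m2 : probability BZ R) : (0 < q)%R ->
  dis q%:E m1 = dis q%:E m2 -> energy q m1 = energy q m2.
Proof.
move=> q0; rewrite /dis -/(energy q m1) -/(energy q m2) => d12.
have inv (m : probability BZ R) :
    energy q m = (2%:E * ((2^-1)%:E * energy q m `^ q^-1)) `^ q.
  rewrite muleA -EFinM mulfV// mul1e -poweRrM mulVf ?gt_eqF//.
  by rewrite poweRe1// energy_ge0.
by rewrite (inv m1) d12 -inv.
Qed.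

Lemma le_dis_energy (q : R) (m1 m2 : probability BZ R) : (0 < q)%R ->
  energy q m1 <= energy q m2 -> dis q%:E m1 <= dis q%:E m2.
Proof.
move=> q0 e12; rewrite /dis -/(energy q m1) -/(energy q m2).
apply: lee_wpmul2l => //.
apply: gt0_ler_poweR => //; first by rewrite invr_ge0 ltW.
  by rewrite in_itv/= energy_ge0 leey.
by rewrite in_itv/= energy_ge0 leey.
Qed.

Lemma d_srGW_attained (p : \bar R) (f : X -> Y) :
  (forall gamma : probability BZ R, semi_coupling gamma ->
     dis p (induced_coupling f) <= dis p gamma) ->
  d_srGW X Y p = dis p (induced_coupling f).
Proof.
move=> fmin; apply/eqP; rewrite eq_le; apply/andP; split.
  have [gamma [scg gE]] := induced_couplingP finX f.
  by apply: ereal_inf_lbound; exists gamma => //; rewrite gE.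
by apply: le_ereal_inf_tmp => _ [gamma scg <-]; exact: fmin.
Qed.

Lemma dis_pinfty_minimizer (G : groupType) (act : G -> Y -> Y) :
  isometric_action act -> cocompact act ->
  exists f : X -> Y, forall gamma : probability BZ R, semi_coupling gamma ->
    dis +oo (induced_coupling f) <= dis +oo gamma.
Proof.
move=> isoG cocG; have [s [us sX]] := exists_enum.
(* The default value 0 of the maximum is harmless, distortions being nonnegative. *)
pose F (f : X -> Y) : R := (\big[Num.max/0]_(i <- s) \big[Num.max/0]_(j <- s)
  distortion (j, f j) (i, f i))%R.
have leF f i j : (distortion (j, f j) (i, f i) <= F f)%R.
  apply: bigmax_sup_seq (sX i) _ _ => //.
  exact: bigmax_sup_seq (sX j) _ _.
have [| | |f fmin] := exists_minimizer (F := F) (point : X) properY isoG cocG.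
- apply: continuous_big => [|i _]; first exact: max_continuous.
  apply: continuous_big => [|j _]; first exact: max_continuous.
  exact: continuous_distortion_graph.
- by move=> g f; rewrite /F; apply: eq_bigr => i _; apply: eq_bigr => j _;
    rewrite (distortion_act _ _ _ _ isoG).
- move=> M.
  exists (M + \sum_(i <- s) \sum_(j <- s) mdist i j)%R => f fM i j.
  apply: le_trans (mdist_le_distortion (i, f i) (j, f j)) _; apply: lerD.
    exact: le_trans (leF f j i) fM.
  rewrite (bigD1_seq i)//= (bigD1_seq j)//= -addrA lerDl.
  rewrite addr_ge0// sumr_ge0// => k _; rewrite ?mdist_ge0// sumr_ge0// => l _.
  exact: mdist_ge0.
exists f => gamma scg; apply: lee_wpmul2l => //.
apply: (@le_trans _ _ (F f)%:E).
  (* The support of the induced coupling lies in the graph of [f]. *)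
  apply: ge_ereal_sup => _ [[a b] sa [[a' b'] sb <-]].
  rewrite lee_fin.
  have /= -> := msupport_induced finX sa; have /= -> := msupport_induced finX sb.
  exact: leF.
have hs x := msupport_fiber finX fullX x properY scg.
(* The graph of [h] lies in the support of [gamma], so [F h] is at most the supremum that defines
   the distortion of [gamma]. *)
pose h x := projT1 (cid (hs x)).
have hP x : msupport gamma (x, h x) by rewrite /h; case: cid.
apply: (@le_trans _ _ (F h)%:E); first by rewrite lee_fin.
set S := ereal_sup _.
have leS i j : (distortion (j, h j) (i, h i))%:E <= S.
  by apply: ereal_sup_ubound; exists (j, h j) => //; exists (i, h i).
have S0 : 0 <= S by apply: le_trans (leS point point); rewrite lee_fin normr_ge0.
clearbody S; case: S leS S0 => [b leS b0|_ _|_]; [|by rewrite leey|by rewrite leeNy_eq].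
rewrite lee_fin; apply: bigmax_le => // i _; apply: bigmax_le => // j _.
by rewrite -lee_fin; exact: leS.
Qed.

End minimizers.

(** * Attainment for every exponent, and rigidity of minimizers for finite exponents *)

Theorem theorem2 (R : realType) (X : mmSpace R)
    (finX : finite_set [set: X])
    (fullX : msupport (mm_measure X) = [set: X])
    (Y : pmetricType R) (properY : proper_space Y)
    (G : groupType) (act : G -> Y -> Y)
    (act_iso : isometric_action act) (act_cocompact : cocompact act)
    (p : \bar R) (p_ge1 : 1 <= p) :
  exists f : X -> Y,
    d_srGW X Y p = dis p (induced_coupling f) /\
    (p < +oo ->
     forall gamma : probability (borel (X * Y)%type) R,
       semi_coupling gamma -> dis p gamma = dis p (induced_coupling f) ->
       exists g : X -> Y, same_measure gamma (induced_coupling g)).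
Proof.
case: p p_ge1 => [q|_|//]; last first.
  have [f fmin] := dis_pinfty_minimizer finX fullX properY act_iso act_cocompact.
  by exists f; split; [exact: d_srGW_attained|rewrite ltxx].
rewrite lee_fin => q1; have q0 : (0 < q)%R by exact: lt_le_trans q1.
have [s [us sX]] := exists_enum finX.
have [f [Ef fmin]] :=
  energy_minimizer finX fullX properY us sX act_iso act_cocompact q1.
have D0 (gamma : probability (borel (X * Y)%type) R) x :
    0 <= \int[slice gamma x]_y' \int[slice gamma x]_y (mdist y y' `^ q)%:E.
  by apply: integral_ge0 => ? _; apply: integral_ge0 => ? _; rewrite lee_fin powR_ge0.
have [gf [_ gfE]] := induced_couplingP finX f.
exists f; rewrite -gfE in Ef fmin *; split.
  rewrite gfE; apply: d_srGW_attained => // gamma scg; rewrite -gfE.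
  apply: le_dis_energy => //.
  by apply: le_trans (fmin _ scg); rewrite leeDl// sume_ge0.
move=> _ gamma scg /(eq_dis_energy q0) gE.
(* With equal and finite energies, cancellation leaves a diagonal surplus of at most zero, so each
   of its nonnegative terms vanishes and every slice is concentrated at one point. *)
have := fmin gamma scg; rewrite gE -[leRHS]adde0 leeD2lE// => sle0.
have s0 : forall x, \int[slice gamma x]_y' \int[slice gamma x]_y (mdist y y' `^ q)%:E = 0.
  move=> x; apply/eqP; rewrite eq_le D0 andbT; apply: le_trans sle0.
  by rewrite (bigD1_seq x)//= leeDl// sume_ge0.
have sN0 x : slice gamma x setT != 0.
  by rewrite (semi_coupling_slice x scg) gt_eqF// measure_set1_gt0.
pose g x := projT1 (cid (slice_concentrated properY q0 (sN0 x) (s0 x))).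
exists g; apply: (same_measure_induced finX us sX scg) => x.
by rewrite /g; case: cid.
Qed.
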